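(* (Double first derivative test) Let $a,b\in\mathbb{R}^2$ with $a<b$. Suppose that $f$ is a double function which is double differentiable on the double open interval $(a,b)$. Let $c\in(a,b)$ be a double stationary point for $f$. (a) Suppose that $f'(x)<0$ when $a<x<c$ or $c<x<b$, and $f'(x)>0$ when $(a_1,c_2)<x<(c_1,b_2)$ or $(c_1,a_2)<x<(b_1,c_2)$. Then $c$ is a double maximum point for $f$ on $(a,b)$. (b) Suppose that $f'(x)>0$ when $a<x<c$ or $c<x<b$, and $f'(x)<0$ when $(a_1,c_2)<x<(c_1,b_2)$ or $(c_1,a_2)<x<(b_1,c_2)$. Then $c$ is a double minimum point for $f$ on $(a,b)$. (c) If $f'$ has the same sign on all four of these regions (that is, either $f'(x)>0$ for every $x$ satisfying $a<x<c$, or $c<x<b$, or $(a_1,c_2)<x<(c_1,b_2)$, or $(c_1,a_2)<x<(b_1,c_2)$; or $f'(x)<0$ for every such $x$), then $c$ is neither a double maximum point nor a double minimum point for $f$ on $(a,b)$.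
   Context: Points of $\mathbb{R}^2$ are written $a=(a_1,a_2)$. $a<b$ means $a_1<b_1$ and $a_2<b_2$; $a\nsim b$ means $a_1\ne b_1$ and $a_2\ne b_2$; $(a,b)=\{x\in\mathbb{R}^2:a<x<b\}$. A double function is a real-valued function $f$ with domain $D(f)\subseteq\mathbb{R}^2$. The double difference is $\Delta_a^b(f)=f(b_1,b_2)-f(b_1,a_2)-f(a_1,b_2)+f(a_1,a_2)$. For $p\nsim x$ put $m_p^x(f)=\Delta_p^x(f)/((x_1-p_1)(x_2-p_2))$. $f$ is double differentiable at $p$ if $D(f)$ contains a product of two open intervals containing $p$ and there is a real number $f'(p)$ (the double derivative) such that for every $\epsilon>0$ there are $\delta_1,\delta_2>0$ such that for all $x$ with $0<|x_1-p_1|<\delta_1$ and $0<|x_2-p_2|<\delta_2$, $m_p^x(f)$ is defined and $|m_p^x(f)-f'(p)|<\epsilon$. $f$ is double differentiable on $(a,b)$ if it is so at each point of $(a,b)$. A point $c$ is a double stationary point for $f$ if $f$ is double differentiable at $c$ and $f'(c)=0$. A point $c\in I=(a,b)$ is a double maximum point (double minimum point) for $f$ on $I$ if $\Delta_c^x(f)<0$ ($\Delta_c^x(f)>0$) for all $x\in I$ with $x\nsim c$. *)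

(* Defs.v *)
From HB Require Import structures.
From mathcomp Require Import all_boot all_order all_algebra.
From mathcomp Require Import all_classical reals.
From mathcomp Require Import lra.
Set Implicit Arguments.
Unset Strict Implicit.
Unset Printing Implicit Defensive.
Import Order.TTheory GRing.Theory Num.Theory.
Local Open Scope classical_set_scope.
Local Open Scope ring_scope.

(* A real function of two variables with an explicit domain; the values of
   [dfun_val] outside [dfun_dom] carry no meaning, and the definitions below
   require the points at which they evaluate [f] to lie in the domain. *)
Record double_function (R : realType) := DoubleFunction {
  dfun_dom : set (R * R);
  dfun_val :> R * R -> R }.

Section DoubleFunctions.
Context {R : realType}.
Implicit Types (f : double_function R) (a b c p x : R * R) (l : R).

(* Strict in both coordinates, unlike the strict part of the product order. *)
Definition dlt a b : Prop := a.1 < b.1 /\ a.2 < b.2.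

Definition nsim a b : Prop := a.1 <> b.1 /\ a.2 <> b.2.

Definition double_itv a b : set (R * R) := [set x | dlt a x /\ dlt x b].

Definition ddiff f a b : R :=
  f (b.1, b.2) - f (b.1, a.2) - f (a.1, b.2) + f (a.1, a.2).

Definition ddiff_defined f a b : Prop :=
  [/\ dfun_dom f (b.1, b.2), dfun_dom f (b.1, a.2),
      dfun_dom f (a.1, b.2) & dfun_dom f (a.1, a.2)].

Definition dquot f p x : R := ddiff f p x / ((x.1 - p.1) * (x.2 - p.2)).

Definition dquot_defined f p x : Prop := nsim p x /\ ddiff_defined f p x.

Definition is_dderive f p l : Prop :=
  (exists u v, double_itv u v p /\ double_itv u v `<=` dfun_dom f) /\
  forall e : R, 0 < e -> exists d1 d2 : R, [/\ 0 < d1, 0 < d2 &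
    forall x, 0 < `|x.1 - p.1| < d1 -> 0 < `|x.2 - p.2| < d2 ->
      dquot_defined f p x /\ `|dquot f p x - l| < e].

Definition dderivable f p : Prop := exists l, is_dderive f p l.

(* Meaningful only where [f] is double differentiable, see [dderiveP];
   the default value is 0. *)
Definition dderive f p : R := xget 0 [set l | is_dderive f p l].

Lemma is_dderive_unique f p l1 l2 :
  is_dderive f p l1 -> is_dderive f p l2 -> l1 = l2.
Proof.
move=> [_ h1] [_ h2]; apply/eqP/negPn/negP => l12.
have e0 : 0 < `|l1 - l2| / 2 by rewrite divr_gt0 // normr_gt0 subr_eq0.
have [d1 [d2 [d10 d20 hd]]] := h1 _ e0.
have [d3 [d4 [d30 d40 hd']]] := h2 _ e0.
have near0 (s t : R) (q : R) : 0 < s -> 0 < t ->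
    exists y, (0 < `|y - q| < s) /\ (0 < `|y - q| < t).
  move=> s0 t0; exists (q + Num.min s t / 2).
  have m0 : 0 < Num.min s t by rewrite lt_min s0.
  have : Num.min s t <= s by rewrite ge_min lexx.
  have : Num.min s t <= t by rewrite ge_min lexx orbT.
  rewrite addrAC subrr add0r ger0_norm; last by lra.
  by move=> *; split; lra.
have [y1 [y1a y1b]] := near0 _ _ p.1 d10 d30.
have [y2 [y2a y2b]] := near0 _ _ p.2 d20 d40.
have [_ k1] := hd (y1, y2) y1a y2a.
have [_ k2] := hd' (y1, y2) y1b y2b.
have : `|l1 - l2| < `|l1 - l2|.
  rewrite {2}(splitr `|l1 - l2|).
  apply: le_lt_trans (ler_distD (dquot f p (y1, y2)) l1 l2) _.
  by rewrite ltrD // distrC.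
by rewrite ltxx.
Qed.

Lemma dderiveP f p l : is_dderive f p l -> dderive f p = l.
Proof.
by move=> h; rewrite /dderive; case: xgetP => [y _ hy | /(_ l) //];
  exact: is_dderive_unique hy h.
Qed.

Definition double_stationary f c : Prop := dderivable f c /\ dderive f c = 0.

Definition double_max_on f a b c : Prop :=
  double_itv a b c /\ forall x, double_itv a b x -> nsim x c ->
    ddiff_defined f c x /\ ddiff f c x < 0.

Definition double_min_on f a b c : Prop :=
  double_itv a b c /\ forall x, double_itv a b x -> nsim x c ->
    ddiff_defined f c x /\ 0 < ddiff f c x.

End DoubleFunctions.

(* Main.v *)
(** The heart of the matter is the sign rule: if the double derivative exists on
    a closed rectangle and is positive on its interior, then the double
    difference over the rectangle is positive. Write this difference as
    [h x2 - h x1] with [h x = g x y2 - g x y1]. Compactness of [[y1, y2]] turns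
    double differentiability along the vertical segment through [x] into
    one-variable information on [h] at [x]: [h] is continuous there, and it is
    increasing there if the derivative is positive along the closed segment.
    Since no sign is known on the boundary, the two variables are treated in
    turn: monotonicity is first obtained on the open side and then extended to
    the endpoints by continuity. Each part of the test applies the rule to a
    multiple [k f] on the four rectangles that have [c] as a corner. *)

Require Import Defs.
From mathcomp Require Import all_boot all_order all_algebra.
From mathcomp Require Import all_classical reals.
From mathcomp Require Import ring lra.
Set Implicit Arguments.
Unset Strict Implicit.
Unset Printing Implicit Defensive.
Import Order.TTheory GRing.Theory Num.Theory.
Local Open Scope classical_set_scope.
Local Open Scope ring_scope.

Section DoubleDerivativeSign.
Context {R : realType}.
Implicit Types (g D : R -> R -> R) (h : R -> R).

(** * Induction along a compact interval *)

(** The supremum of the points reachable from [u] is itself reached, by the left-hand local property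
    there, and the right-hand one would pass beyond it if it were less than [v]. This replaces the
    choice of a finite subcover of [[u, v]]. *)
Lemma interval_induction (P : R -> R -> Prop) (u v : R) : u < v ->
    (forall r s t, u <= r -> r < s -> s < t -> t <= v ->
       P r s -> P s t -> P r t) ->
    (forall z, u <= z <= v -> exists2 d, 0 < d &
       (forall r, u <= r -> z - d < r -> r < z -> P r z) /\
       (forall s, s <= v -> z < s -> s < z + d -> P z s)) ->
  P u v.
Proof.
move=> uv Padd Ploc.
pose S := [set t | [/\ u < t, t <= v & P u t]].
have step z d : z < v -> 0 < d -> exists s, [/\ z < s, s <= v & s < z + d].
  move=> zv d0; have [dv|vd] := lerP (z + d / 2) v.
    by exists (z + d / 2); split; lra.
  by exists v; split; lra.
have supS : has_sup S.
  split; last by exists v => t [].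
  have [|d d0 [_ dr]] := Ploc u; first by lra.
  have [s [us sv sd]] := step _ _ uv d0.
  by exists s; split => //; exact: dr.
set m := sup S.
have mle t : S t -> t <= m by apply: sup_upper_bound.
have mv : m <= v by apply: ge_sup; [case: supS | move=> t []].
have um : u < m.
  by case: supS => -[t St] _; apply: lt_le_trans (mle _ St); case: St.
have [|d d0 [dl dr]] := Ploc m; first by lra.
have Pum : P u m.
  have [t St tm] := sup_adherent d0 supS.
  have tlem := mle _ St; case: St => ut tv Put.
  move: tlem; rewrite le_eqVlt => /orP[/eqP <- //|tltm].
  by apply: (Padd _ t) => //; apply: dl => //; exact: ltW.
move: mv; rewrite le_eqVlt => /orP[/eqP <- //|mltv].
have [s [ms sv sd]] := step _ _ mltv d0.
have /mle : S s.
  by split; [lra | | apply: (Padd _ m) => //; exact: dr].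
by rewrite leNgt ms.
Qed.

(** * Continuity and monotonicity in one variable *)

Definition cont_at h z := forall e, 0 < e ->
  exists2 d, 0 < d & forall x, 0 < `|x - z| < d -> `|h x - h z| < e.

Lemma cont_at_opp h z : cont_at h z -> cont_at (fun x => - h x) z.
Proof.
move=> hz e /hz[d d0 hd]; exists d => // x /hd.
by rewrite -opprD normrN.
Qed.

Lemma cont_at_le h z c : cont_at h z ->
  (forall d, 0 < d -> exists2 x, 0 < `|x - z| < d & h x <= c) -> h z <= c.
Proof.
move=> hz near; rewrite leNgt; apply/negP => cz.
have [|d d0 hd] := hz (h z - c); first by lra.
have [x /hd + xc] := near _ d0.
by rewrite ltr_norml; lra.
Qed.

(** Continuity gives only weak inequalities at the ends; strictness comes from two fixed interior
    points, through [h p <= h m < h n <= h q]. *)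
Lemma increasing_closure h p q : p < q -> cont_at h p -> cont_at h q ->
  (forall u v, p < u -> u < v -> v < q -> h u < h v) -> h p < h q.
Proof.
move=> pq hp hq inc.
pose m := p + (q - p) / 3; pose n := p + 2 * (q - p) / 3.
have pm : p < m by rewrite /m; lra.
have mn : m < n by rewrite /m /n; lra.
have nq : n < q by rewrite /n; lra.
have small (d l : R) : 0 < d -> 0 < l -> exists2 r, 0 < r & r < d /\ r < l.
  move=> d0 l0; have [dl|ld] := lerP d l.
    by exists (d / 2); lra.
  by exists (l / 2); lra.
have hpm : h p <= h m.
  apply: cont_at_le => // d d0.
  have [|r r0 [rd rm]] := small d (m - p) d0; first by lra.
  exists (p + r); first by rewrite addrAC subrr add0r gtr0_norm // r0.
  by apply/ltW/inc; lra.
have hnq : - h q <= - h n.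
  apply: (cont_at_le (cont_at_opp hq)) => d d0.
  have [|r r0 [rd rn]] := small d (q - n) d0; first by lra.
  exists (q - r); first by rewrite addrAC subrr add0r normrN gtr0_norm // r0.
  by rewrite lerN2; apply/ltW/inc; lra.
have hmn : h m < h n by apply: inc.
by lra.
Qed.

(** * Double differentiability along a segment *)

Definition box_diff g x1 y1 x2 y2 := g x2 y2 - g x2 y1 - g x1 y2 + g x1 y1.

Definition is_box_derive g x y (l : R) := forall e, 0 < e ->
  exists2 d, 0 < d & forall s t, 0 < `|s - x| < d -> 0 < `|t - y| < d ->
    `|box_diff g x y s t / ((s - x) * (t - y)) - l| < e.

Lemma is_box_derive_swap g x y l :
  is_box_derive g x y l -> is_box_derive (fun s t => g t s) y x l.
Proof.
move=> gl e /gl[d d0 gd]; exists d => // s t sy tx.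
have -> : box_diff (fun s t => g t s) y x s t = box_diff g x y t s.
  by rewrite /box_diff; ring.
by rewrite [(s - y) * _]mulrC gd.
Qed.

Lemma is_box_derive_scale k g x y l :
  is_box_derive g x y l -> is_box_derive (fun s t => k * g s t) x y (k * l).
Proof.
move=> gl e e0; have k0 : 0 < `|k| + 1 by rewrite ltr_wpDl.
have [d d0 gd] := gl _ (divr_gt0 e0 k0); exists d => // s t sx ty.
have -> : box_diff (fun s t => k * g s t) x y s t = k * box_diff g x y s t.
  by rewrite /box_diff; ring.
rewrite -mulrA -mulrBr normrM.
have := gd _ _ sx ty; rewrite ltr_pdivlMr // mulrDr mulr1 mulrC.
by apply: le_lt_trans; rewrite lerDl.
Qed.

(** This is the difference quotient between [x] and [s] of the function [h s = g s y2 - g s y1].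
    Being additive in the vertical interval, it is suited to [interval_induction]. *)
Definition strip_slope g x y1 y2 s := box_diff g x y1 s y2 / (s - x).

Lemma strip_slope_add g x y1 y2 y3 s :
  strip_slope g x y1 y3 s = strip_slope g x y1 y2 s + strip_slope g x y2 y3 s.
Proof. by rewrite /strip_slope -mulrDl /box_diff; congr (_ / _); ring. Qed.

(** The estimate of the double quotient is multiplied by the height of the strip. The two clauses,
    for strips below and above [y], are the local data for [interval_induction]. *)
Lemma strip_slope_near g x y l e : is_box_derive g x y l -> 0 < e ->
  exists2 d, 0 < d & forall s, 0 < `|s - x| < d ->
    (forall r, y - d < r -> r < y ->
       `|strip_slope g x r y s - l * (y - r)| < e * (y - r)) /\
    (forall r, y < r -> r < y + d ->
       `|strip_slope g x y r s - l * (r - y)| < e * (r - y)).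
Proof.
move=> gl /gl[d d0 gd]; exists d => // s sx; have sx' := sx.
have s0 : s - x != 0 by rewrite -normr_gt0; case/andP: sx.
have scale r : 0 < `|r - y| < d ->
    `|strip_slope g x y r s - l * (r - y)| < e * `|r - y|.
  move=> ry; have r0 : r - y != 0 by rewrite -normr_gt0; case/andP: ry.
  rewrite -ltr_pdivrMr ?normr_gt0 // -normf_div.
  have -> : (strip_slope g x y r s - l * (r - y)) / (r - y)
      = box_diff g x y s r / ((s - x) * (r - y)) - l.
    by rewrite /strip_slope; field; rewrite r0.
  exact: gd.
split=> r r1 r2.
  have : `|strip_slope g x y r s - l * (r - y)| < e * `|r - y|.
    by apply: scale; rewrite ltr0_norm; lra.
  rewrite (ltr0_norm (x := r - y)); last by lra.
  have -> : strip_slope g x y r s = - strip_slope g x r y s.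
    by rewrite /strip_slope -mulNr /box_diff; congr (_ / _); ring.
  have -> : - strip_slope g x r y s - l * (r - y)
      = - (strip_slope g x r y s - l * (y - r)) by ring.
  by rewrite normrN opprB.
have : `|strip_slope g x y r s - l * (r - y)| < e * `|r - y|.
  by apply: scale; rewrite gtr0_norm; lra.
by rewrite (gtr0_norm (x := r - y)) //; lra.
Qed.

(** The radius is part of the inductive property because it shrinks whenever two strips are
    stacked. *)
Lemma strip_slope_gt0 g D x y1 y2 : y1 < y2 ->
    (forall y, y1 <= y <= y2 -> is_box_derive g x y (D x y)) ->
    (forall y, y1 <= y <= y2 -> 0 < D x y) ->
  exists2 d, 0 < d & forall s, 0 < `|s - x| < d -> 0 < strip_slope g x y1 y2 s.
Proof.
move=> y12 gD D0.
apply: (interval_induction (P := fun r t => exists2 d, 0 < d &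
  forall s, 0 < `|s - x| < d -> 0 < strip_slope g x r t s)) => //.
  move=> r s t _ _ _ _ [d d0 hd] [d' d'0 hd'].
  exists (Num.min d d'); first by rewrite lt_min d0.
  move=> z; rewrite lt_min => /and3P[z0 zd zd'].
  by rewrite (strip_slope_add _ _ _ s) addr_gt0 ?hd ?hd' ?z0.
(* With tolerance [D x z], the slope of a short strip at [z] differs from [D x z] times its height
   by less than that very product, so it is positive. *)
move=> z z12; have [d d0 hd] := strip_slope_near (gD _ z12) (D0 _ z12).
exists d => //; split=> [r _ r1 r2|r _ r1 r2]; exists d => // s /hd[hl hr].
  by have := hl _ r1 r2; rewrite ltr_norml; lra.
by have := hr _ r1 r2; rewrite ltr_norml; lra.
Qed.

(** A bound [M] on the slopes near [x] makes the increment of the function at most [M] times that of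
    its argument. The bound comes from the same induction, adding up as strips are stacked. *)
Lemma strip_cont_at g D x y1 y2 : y1 < y2 ->
    (forall y, y1 <= y <= y2 -> is_box_derive g x y (D x y)) ->
  cont_at (fun s => g s y2 - g s y1) x.
Proof.
move=> y12 gD.
have [M M0 [d d0 hd]] : exists2 M, 0 < M & exists2 d, 0 < d &
    forall s, 0 < `|s - x| < d -> `|strip_slope g x y1 y2 s| < M.
  apply: (interval_induction (P := fun r t => exists2 M, 0 < M &
    exists2 d, 0 < d &
      forall s, 0 < `|s - x| < d -> `|strip_slope g x r t s| < M)) => //.
    move=> r s t _ _ _ _ [M M0 [d d0 hd]] [M' M'0 [d' d'0 hd']].
    exists (M + M'); first exact: addr_gt0.
    exists (Num.min d d'); first by rewrite lt_min d0.
    move=> z; rewrite lt_min => /and3P[z0 zd zd'].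
    rewrite (strip_slope_add _ _ _ s); apply: le_lt_trans (ler_normD _ _) _.
    by rewrite ltrD ?hd ?hd' ?z0.
  (* Tolerance 1 bounds the slope by [|D x z| + 1] times the height. *)
  move=> z z12; have [d d0 hd] := strip_slope_near (gD _ z12) ltr01.
  have bound w q : 0 < q -> `|w - D x z * q| < 1 * q ->
      `|w| < (`|D x z| + 1) * q.
    move=> q0 wq; rewrite -[w](subrK (D x z * q)).
    apply: le_lt_trans (ler_normD _ _) _.
    by rewrite normrM (gtr0_norm q0); lra.
  have K0 : 0 < `|D x z| + 1 by rewrite ltr_wpDl.
  exists d => //; split=> r _ r1 r2.
    exists ((`|D x z| + 1) * (z - r)); first by rewrite mulr_gt0 // subr_gt0.
    exists d => // s /hd[hl _]; apply: bound; first by lra.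
    exact: hl.
  exists ((`|D x z| + 1) * (r - z)); first by rewrite mulr_gt0 // subr_gt0.
  exists d => // s /hd[_ hr]; apply: bound; first by lra.
  exact: hr.
move=> e e0; exists (Num.min d (e / M)); first by rewrite lt_min d0 divr_gt0.
move=> s; rewrite lt_min => /and3P[s0 sd]; rewrite ltr_pdivlMr // => sM.
have -> : g s y2 - g s y1 - (g x y2 - g x y1)
    = strip_slope g x y1 y2 s * (s - x).
  by rewrite /strip_slope divfK -?normr_gt0 // /box_diff; ring.
rewrite normrM mulrC; apply: le_lt_trans sM.
by rewrite ler_wpM2l // ltW // hd // s0.
Qed.

(** * Sign of the double difference over a rectangle *)

(** The induction now runs horizontally; [strip_slope_gt0] supplies the sign on both sides of each
    abscissa. *)
Lemma box_diff_gt0_closed g D x1 y1 x2 y2 : x1 < x2 -> y1 < y2 ->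
    (forall x y, x1 <= x <= x2 -> y1 <= y <= y2 -> is_box_derive g x y (D x y)) ->
    (forall x y, x1 <= x <= x2 -> y1 <= y <= y2 -> 0 < D x y) ->
  0 < box_diff g x1 y1 x2 y2.
Proof.
move=> x12 y12 gD D0.
apply: (interval_induction (P := fun r t => 0 < box_diff g r y1 t y2)) => //.
  by move=> r s t _ _ _ _; rewrite /box_diff; lra.
move=> z z12.
have [d d0 hd] : exists2 d, 0 < d & forall s, 0 < `|s - z| < d ->
    0 < strip_slope g z y1 y2 s.
  by apply: (@strip_slope_gt0 g D) => // y y12'; [exact: gD | exact: D0].
exists d => //; split=> [r _ r1 r2|s _ s1 s2].
  (* To the left of [z], the negative denominator [r - z] compensates for the reversed orientation
     of the rectangle. *)
  have : 0 < strip_slope g z y1 y2 r by apply: hd; rewrite ltr0_norm; lra.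
  rewrite /strip_slope nmulr_lgt0 ?invr_lt0 ?subr_lt0 //.
  by rewrite /box_diff; lra.
have : 0 < strip_slope g z y1 y2 s by apply: hd; rewrite gtr0_norm; lra.
by rewrite /strip_slope pmulr_lgt0 ?invr_gt0 ?subr_gt0.
Qed.

Lemma box_diff_gt0 g D x1 y1 x2 y2 : x1 < x2 -> y1 < y2 ->
    (forall x y, x1 <= x <= x2 -> y1 <= y <= y2 -> is_box_derive g x y (D x y)) ->
    (forall x y, x1 < x < x2 -> y1 < y < y2 -> 0 < D x y) ->
  0 < box_diff g x1 y1 x2 y2.
Proof.
move=> x12 y12 gD D0.
suff : g x1 y2 - g x1 y1 < g x2 y2 - g x2 y1 by rewrite /box_diff; lra.
apply: (@increasing_closure (fun s => g s y2 - g s y1)) => //.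
- by apply: (@strip_cont_at g D) => // y yb; apply: gD => //; lra.
- by apply: (@strip_cont_at g D) => // y yb; apply: gD => //; lra.
move=> u v xu uv vx.
(* The four values are regrouped so that the second variable can be treated with [u] and [v]
   fixed. *)
suff : g v y1 - g u y1 < g v y2 - g u y2 by lra.
have cont y : y1 <= y <= y2 -> cont_at (fun t => g v t - g u t) y.
  move=> yb; apply: (@strip_cont_at (fun s t => g t s) (fun s t => D t s)) => //.
  by move=> x xb; apply: is_box_derive_swap; apply: gD => //; lra.
apply: (@increasing_closure (fun t => g v t - g u t)) => //.
- by apply: cont; lra.
- by apply: cont; lra.
move=> s t ys st ty.
(* The closed rectangle [[u, v] x [s, t]] lies inside the open one, so the derivative is positive up
   to its boundary. *)
suff : 0 < box_diff g u s v t by rewrite /box_diff; lra.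
by apply: (@box_diff_gt0_closed g D) => // x y xb yb; [apply: gD|apply: D0]; lra.
Qed.

(** * Rectangles with a corner at [c] *)

Lemma nsim_quadrants (x c : R * R) : nsim x c ->
  (dlt x c \/ dlt c x) \/
  ((x.1 < c.1 /\ c.2 < x.2) \/ (c.1 < x.1 /\ x.2 < c.2)).
Proof.
by move=> [/eqP + /eqP]; rewrite !neq_lt => /orP[x1|x1] /orP[x2|x2];
  [left; left | right; left | right; right | left; right].
Qed.

Lemma is_dderive_box (f : double_function R) p l :
  is_dderive f p l -> is_box_derive (fun x y => f (x, y)) p.1 p.2 l.
Proof.
move=> [_ fl] e /fl[d1 [d2 [d10 d20 fd]]].
exists (Num.min d1 d2); first by rewrite lt_min d10.
move=> s t; rewrite !lt_min => /and3P[s0 s1 _] /and3P[t0 _ t2].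
by have [||_] := fd (s, t); rewrite /= ?s0 ?t0.
Qed.

Lemma dderivable_dom (f : double_function R) p : dderivable f p -> dfun_dom f p.
Proof. by move=> [l [[u [v [puv]]] + _]]; exact. Qed.

Section Rectangles.
Variables (f : double_function R) (a b : R * R).
Hypothesis fab : forall x, double_itv a b x -> dderivable f x.

(** The closed rectangle spanned by two points of the open [(a, b)] stays inside it, so the
    derivative exists on the sides as well. *)
Let f_box_derive p q : double_itv a b p -> double_itv a b q ->
  forall x y, p.1 <= x <= q.1 -> p.2 <= y <= q.2 ->
  is_box_derive (fun x y => f (x, y)) x y (dderive f (x, y)).
Proof.
move=> [[ap1 ap2] _] [_ [qb1 qb2]] x y xb yb.
have [|l fl] := fab (x := (x, y)).
  by split; split => /=; lra.
by rewrite (dderiveP fl); exact: (is_dderive_box fl).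
Qed.

Lemma ddiff_sign k p q : double_itv a b p -> double_itv a b q -> dlt p q ->
  (forall x, double_itv p q x -> 0 < k * dderive f x) -> 0 < k * ddiff f p q.
Proof.
move=> pab qab [pq1 pq2] D0.
have : 0 < box_diff (fun x y => k * f (x, y)) p.1 p.2 q.1 q.2.
  apply: (@box_diff_gt0 _ (fun x y => k * dderive f (x, y))) => //.
    by move=> x y xb yb; apply/is_box_derive_scale/(f_box_derive pab qab).
  by move=> x y /andP[? ?] /andP[? ?]; apply: D0.
by rewrite /box_diff /ddiff !mulrDr !mulrN.
Qed.

Lemma ddiff_defined_itv p q : double_itv a b p -> double_itv a b q ->
  ddiff_defined f p q.
Proof.
move=> [[? ?] [? ?]] [[? ?] [? ?]].
by split; apply/dderivable_dom/fab.
Qed.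

(** Exchanging the two corners leaves the double difference unchanged, so [x] may lie on either side
    of [c]. *)
Lemma ddiff_diagonal_quadrants k c x : double_itv a b c -> double_itv a b x ->
    dlt x c \/ dlt c x ->
    (forall y, double_itv a c y \/ double_itv c b y -> 0 < k * dderive f y) ->
  0 < k * ddiff f c x.
Proof.
move=> cab xab; have [[ax1 ax2] [xb1 xb2]] := xab.
have ddiffC : ddiff f c x = ddiff f x c by rewrite /ddiff; ring.
case=> [xc|cx] D0; [rewrite ddiffC|]; apply: ddiff_sign => //.
  move=> y [[xy1 xy2] yc]; apply: D0; left; split => //.
  by split; [exact: lt_trans xy1 | exact: lt_trans xy2].
move=> y [cy [yx1 yx2]]; apply: D0; right; split => //.
by split; [exact: lt_trans xb1 | exact: lt_trans xb2].
Qed.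

(** Here [c] and [x] are the upper left and lower right corners, in some order; exchanging one
    coordinate between them reverses the sign of the double difference. *)
Lemma ddiff_antidiagonal_quadrants k c x :
    double_itv a b c -> double_itv a b x ->
    (x.1 < c.1 /\ c.2 < x.2) \/ (c.1 < x.1 /\ x.2 < c.2) ->
    (forall y, double_itv (a.1, c.2) (c.1, b.2) y \/
               double_itv (c.1, a.2) (b.1, c.2) y -> 0 < k * dderive f y) ->
  k * ddiff f c x < 0.
Proof.
move=> [[ac1 ac2] [cb1 cb2]] [[ax1 ax2] [xb1 xb2]] xc D0.
suff : 0 < k * ddiff f (x.1, c.2) (c.1, x.2) \/
       0 < k * ddiff f (c.1, x.2) (x.1, c.2).
  have -> : ddiff f (c.1, x.2) (x.1, c.2) = - ddiff f c x.
    by rewrite /ddiff /=; ring.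
  have -> : ddiff f (x.1, c.2) (c.1, x.2) = - ddiff f c x.
    by rewrite /ddiff /=; ring.
  by rewrite mulrN oppr_gt0; case.
case: xc => [[xc1 cx2]|[cx1 xc2]]; [left|right]; apply: ddiff_sign => //.
  move=> y [[/= xy1 cy2] [/= yc1 yx2]]; apply: D0; left; split; split => //=.
    exact: lt_trans xy1.
  exact: lt_trans xb2.
move=> y [[/= cy1 xy2] [/= yx1 yc2]]; apply: D0; right; split; split => //=.
  exact: lt_trans xy2.
exact: lt_trans xb1.
Qed.

End Rectangles.
End DoubleDerivativeSign.

Theorem proposition26 (R : realType) (f : double_function R) (a b c : R * R)
    (hab : dlt a b)
    (hf : forall x, double_itv a b x -> dderivable f x)
    (hc : double_itv a b c)
    (hstat : double_stationary f c) :
  [/\ (forall x, double_itv a c x \/ double_itv c b x -> dderive f x < 0) ->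
      (forall x, double_itv (a.1, c.2) (c.1, b.2) x \/
                 double_itv (c.1, a.2) (b.1, c.2) x -> 0 < dderive f x) ->
      double_max_on f a b c,
      (forall x, double_itv a c x \/ double_itv c b x -> 0 < dderive f x) ->
      (forall x, double_itv (a.1, c.2) (c.1, b.2) x \/
                 double_itv (c.1, a.2) (b.1, c.2) x -> dderive f x < 0) ->
      double_min_on f a b c
    & (forall x, [\/ double_itv a c x, double_itv c b x,
                     double_itv (a.1, c.2) (c.1, b.2) x
                   | double_itv (c.1, a.2) (b.1, c.2) x] -> 0 < dderive f x) \/
      (forall x, [\/ double_itv a c x, double_itv c b x,
                     double_itv (a.1, c.2) (c.1, b.2) x
                   | double_itv (c.1, a.2) (b.1, c.2) x] -> dderive f x < 0) ->
      ~ double_max_on f a b c /\ ~ double_min_on f a b c].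
Proof.
have defc x : double_itv a b x -> ddiff_defined f c x.
  by apply: ddiff_defined_itv.
have diag k x := @ddiff_diagonal_quadrants _ f a b hf k c x hc.
have anti k x := @ddiff_antidiagonal_quadrants _ f a b hf k c x hc.
split.
- move=> Dlt Dgt; split=> // x xab xc; split; first exact: defc.
  case: (nsim_quadrants xc) => xq.
    have := diag (-1) x xab xq; rewrite mulN1r oppr_gt0; apply=> y /Dlt.
    by rewrite mulN1r oppr_gt0.
  by have := anti 1 x xab xq; rewrite mul1r; apply=> y /Dgt; rewrite mul1r.
- move=> Dgt Dlt; split=> // x xab xc; split; first exact: defc.
  case: (nsim_quadrants xc) => xq.
    by have := diag 1 x xab xq; rewrite mul1r; apply=> y /Dgt; rewrite mul1r.
  have := anti (-1) x xab xq; rewrite mulN1r oppr_lt0; apply=> y /Dlt.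
  by rewrite mulN1r oppr_gt0.
move=> Dsign.
(* A factor 1 or -1 merges the two possible signs into one case. *)
have [k kD] : exists k, forall x,
    [\/ double_itv a c x, double_itv c b x,
        double_itv (a.1, c.2) (c.1, b.2) x
      | double_itv (c.1, a.2) (b.1, c.2) x] -> 0 < k * dderive f x.
  case: Dsign => Dx; [exists 1 | exists (-1)] => x /Dx; first by rewrite mul1r.
  by rewrite mulN1r oppr_gt0.
have [[ac1 ac2] [cb1 cb2]] := hc.
(* [x] lies in a diagonal quadrant at [c] and [y] in an antidiagonal one, so a common sign of the
   derivative gives double differences of opposite signs. *)
pose x := ((c.1 + b.1) / 2, (c.2 + b.2) / 2).
pose y := ((a.1 + c.1) / 2, (c.2 + b.2) / 2).
have xab : double_itv a b x by split; split; rewrite /x /=; lra.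
have yab : double_itv a b y by split; split; rewrite /y /=; lra.
have xc : nsim x c by split; rewrite /x /=; lra.
have yc : nsim y c by split; rewrite /y /=; lra.
have kx : 0 < k * ddiff f c x.
  apply: diag => //; first by right; split; rewrite /x /=; lra.
  by move=> z [?|?]; apply: kD; [constructor 1 | constructor 2].
have ky : k * ddiff f c y < 0.
  apply: anti => //; first by left; split; rewrite /y /=; lra.
  by move=> z [?|?]; apply: kD; [constructor 3 | constructor 4].
split=> -[_ ext].
  (* Equal signs at [x] and [y] would force [k] to be both positive and negative. *)
  have [_ fx] := ext x xab xc; have [_ fy] := ext y yab yc.
  by move: kx ky; rewrite (nmulr_lgt0 _ fx) (nmulr_llt0 _ fy); lra.
have [_ fx] := ext x xab xc; have [_ fy] := ext y yab yc.
by move: kx ky; rewrite (pmulr_lgt0 _ fx) (pmulr_llt0 _ fy); lra.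
Qed.
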